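(* Let $P$ be a directed set equipped with a second-countable topology in which every convergent sequence in $P$ is bounded. If a topological space $X$ has a $P$-base, then $X$ has the strong Pytkeev$^\ast$ property.
   Context: All topological spaces are assumed to be Tychonoff. A poset is directed if any two elements have a common upper bound. ''Every convergent sequence is bounded'' means that whenever a sequence in $P$ converges in the given topology, the set of its terms has an upper bound in $P$. A subset $C$ of a poset $P$ is cofinal if for every $p\in P$ there is $q\in C$ with $p\leq q$. For directed sets $P,Q$, $Q$ is a Tukey quotient of $P$ if there is a map $\phi:P\to Q$ carrying cofinal subsets of $P$ to cofinal subsets of $Q$. A space $X$ has a neighborhood $P$-base at $x\in X$ if the poset of neighborhoods of $x$, ordered by reverse inclusion, is a Tukey quotient of $P$ (equivalently, there is a neighborhood base $\{U_p:p\in P\}$ at $x$ with $U_q\subseteq U_p$ whenever $p\leq q$). $X$ has a $P$-base if it has a neighborhood $P$-base at each of its points. A sequence $\{x_n:n\in\omega\}$ accumulates at $x$ if every neighborhood of $x$ contains $x_n$ for infinitely many $n$. A family $\mathcal{N}$ of subsets of $X$ is a Pytkeev$^\ast$-network at $x$ if for any neighborhood $O_x$ of $x$ and any sequence $\{x_n:n\in\omega\}$ in $X$ that accumulates at $x$ there exists $N\in\mathcal{N}$ such that $N\subseteq O_x$ and the set $\{n\in\omega:x_n\in N\}$ is infinite. $X$ has the strong Pytkeev$^\ast$ property if it has a countable Pytkeev$^\ast$-network at each of its points. *)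

(* Defs.v *)
From HB Require Import structures.
From mathcomp Require Import all_boot all_order all_algebra.
From mathcomp Require Import all_classical all_reals all_analysis.

Set Implicit Arguments.
Unset Strict Implicit.
Unset Printing Implicit Defensive.

Local Open Scope classical_set_scope.
Local Open Scope order_scope.

Definition tychonoff_space (T : topologicalType) : Prop :=
  accessible_space T /\ completely_regular_space T.

Definition directed (A : Type) (le : A -> A -> Prop) : Prop :=
  forall a b : A, exists c : A, le a c /\ le b c.

Definition cofinal (A : Type) (le : A -> A -> Prop) (C : set A) : Prop :=
  forall a : A, exists2 c : A, C c & le a c.

Definition tukey_quotient (A B : Type)
    (leA : A -> A -> Prop) (leB : B -> B -> Prop) : Prop :=
  exists phi : A -> B,
    forall C : set A, cofinal leA C -> cofinal leB (phi @` C).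

Definition neighborhood (X : topologicalType) (x : X) : Type :=
  {U : set X | nbhs x U}.

Definition nbhd_le (X : topologicalType) (x : X)
    (U V : neighborhood x) : Prop :=
  sval V `<=` sval U.

Definition poset_le (d : Order.disp_t) (P : porderType d) (p q : P) : Prop :=
  p <= q.

Definition has_neighborhood_base (d : Order.disp_t) (P : porderType d)
    (X : topologicalType) (x : X) : Prop :=
  tukey_quotient (@poset_le d P) (@nbhd_le X x).

Definition has_base (d : Order.disp_t) (P : porderType d)
    (X : topologicalType) : Prop :=
  forall x : X, has_neighborhood_base P x.

(* The order and the topology of P are not assumed to be related: a
   POrderedTopological type is just a type carrying both structures. *)
Definition convergent_sequences_bounded (d : Order.disp_t)
    (P : POrderedTopological.type d) : Prop :=
  forall (u : nat -> P) (l : P), u @ \oo --> l ->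
    exists b : P, forall n : nat, u n <= b.

Definition seq_clusters_at (X : topologicalType) (u : nat -> X) (x : X) : Prop :=
  forall U : set X, nbhs x U -> infinite_set [set n | U (u n)].

Definition pytkeev_star_network (X : topologicalType) (x : X)
    (NN : set (set X)) : Prop :=
  forall (O : set X) (u : nat -> X), nbhs x O -> seq_clusters_at u x ->
    exists N : set X,
      [/\ NN N, N `<=` O & infinite_set [set n | N (u n)]].

Definition strong_pytkeev_star (X : topologicalType) : Prop :=
  forall x : X, exists2 NN : set (set X), countable NN &
    pytkeev_star_network x NN.

(* Main.v *)
(** A Tukey quotient onto the neighborhoods of [x] yields an antitone base [U]
    at [x] indexed by [P]. The sets [\bigcap_(q in B) U q], where [B] runs over
    a countable basis of [P], form the network. Indeed, let [U p `<=` O] and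
    suppose that for every basic [B] containing [p] the intersection contains
    only finitely many terms of the sequence [u]. Diagonalizing along a
    decreasing neighborhood base at [p] gives [q k] converging to [p] such that
    [u k] is not in [U (q k)] for all large [k]. An upper bound [b] of the [q k]
    satisfies [U b `<=` U (q k)], so [U b] contains only finitely many terms
    of [u], and [u] does not accumulate at [x]. *)

Require Import Defs.
From mathcomp Require Import all_boot all_order all_algebra.
From mathcomp Require Import all_classical all_reals all_analysis.

Local Open Scope classical_set_scope.
Local Open Scope order_scope.

Lemma finite_set_near_infty (A : set nat) :
  finite_set A <-> \forall n \near \oo, ~ A n.
Proof.
split=> [/finite_seqP[s ->]|[N _ hN]].
  exists (\max_(i <- s) i).+1 => // n /= lt_s_n sn.
  by have := @leq_bigmax_seq _ s xpredT (fun i => i) n sn isT; rewrite leqNgt lt_s_n.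
apply: (@sub_finite_set _ _ `I_N); last exact: finite_II.
move=> n An /=; rewrite ltnNge; apply/negP => le_Nn.
exact: hN An.
Qed.

(** Otherwise the [a] with [~ leB b (phi a)] form a cofinal set, yet no point of its image lies
    above [b]. *)
Lemma cofinal_map_eventually {A B : Type} (leA : A -> A -> Prop)
    (leB : B -> B -> Prop) (phi : A -> B) :
  (forall C : set A, cofinal leA C -> cofinal leB (phi @` C)) ->
  forall b : B, exists a : A, forall a' : A, leA a a' -> leB b (phi a').
Proof.
move=> phi_cof b; apply: contrapT => /forallNP noa.
have /phi_cof /(_ b)[_ [a nba <-] //] : cofinal leA [set a | ~ leB b (phi a)].
by move=> a; have /existsNP[a' /not_implyP[le_aa' nb]] := noa a; exists a'.
Qed.

Lemma antitone_neighborhood_base {d : Order.disp_t} {P : porderType d}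
    {X : topologicalType} {x : X} :
  has_neighborhood_base P x ->
  exists U : P -> set X,
    [/\ forall p, nbhs x (U p), forall p q, p <= q -> U q `<=` U p &
        forall O, nbhs x O -> exists p, U p `<=` O].
Proof.
move=> [phi /cofinal_map_eventually phi_ev].
(* [phi] need not be monotone: the union over all [q] above [p] forces antitonicity, and it stays
   inside [O] for a suitable [p] because [sval (phi q)] does for every [q] above that [p]. *)
exists (fun p => \bigcup_(q in [set q | p <= q]) sval (phi q)); split.
- move=> p; apply: filterS (svalP (phi p)) => y phi_y.
  by exists p => //=.
- by move=> p q le_pq y [r /= le_qr yr]; exists r => //=; apply: Order.POrderTheory.le_trans le_qr.
- move=> O xO; have [p hp] := phi_ev (exist _ O xO).
  by exists p => y [q /= le_pq]; apply: hp.
Qed.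

Lemma second_countable_decreasing_base {T : topologicalType} (x : T) :
  @second_countable T ->
  exists V : nat -> set T,
    [/\ forall n, nbhs x (V n), forall m n, (m <= n)%N -> V n `<=` V m &
        forall O, nbhs x O -> exists n, V n `<=` O].
Proof.
move=> [B B_count [B_open B_base]].
pose Bx := [set U | B U /\ U x].
have /pfcard_geP[Bx0|[C]] : countable Bx.
- by apply: sub_countable B_count; apply: subset_card_le => U [].
- have [U BxU _] := B_base x setT filterT.
  by move: BxU; rewrite -/Bx Bx0.
have CBx n : Bx (C n) by exact: funS.
exists (fun n => [set y | forall i, (i <= n)%N -> C i y]); split.
- move=> n.
  have Cx i : nbhs x (C i).
    by have [BC Cx] := CBx i; apply: open_nbhs_nbhs; split => //; apply: B_open.
  elim: n => [|n IHn].
    by apply: filterS (Cx 0%N) => y C0y i; rewrite leqn0 => /eqP->.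
  apply: filterS2 IHn (Cx n.+1) => y Vy Cy i.
  by rewrite leq_eqVlt => /predU1P[->|/Vy].
- by move=> m n le_mn y Vy i le_im; apply: Vy; apply: leq_trans le_mn.
- move=> O xO; have [U BxU UO] := B_base x O xO.
  have [n _ CnU] := @surj _ _ _ _ C U BxU.
  by exists n => y /(_ n (leqnn n)); rewrite CnU => /UO.
Qed.

Lemma diagonal_sequence {T : topologicalType} (x : T) (R : nat -> set T) :
  @second_countable T ->
  (forall V, nbhs x V -> \forall k \near \oo, V `&` R k !=set0) ->
  exists2 q : nat -> T, q @ \oo --> x & \forall k \near \oo, R k (q k).
Proof.
move=> /(@second_countable_decreasing_base _ x)[V [Vx V_dec V_base]] R_near.
(* [good m k q] asks [q] to lie in [R k] and in the smallest of [V 0], ..., [V m] that meets [R k],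
   if any does. Taking [m = k] lets the depth grow with [k], so by [R_near] the chosen points
   converge to [x]. *)
pose good m k q := forall n, (n <= m)%N -> V n `&` R k !=set0 -> (V n `&` R k) q.
have good_ex m k : exists q, good m k q.
  elim: m => [|m [q qm]].
  - have [[q VRq]|V0] := pselect (V 0%N `&` R k !=set0).
      by exists q => n; rewrite leqn0 => /eqP->.
    (* Here the condition is vacuous, so any point serves. *)
    by exists x => n; rewrite leqn0 => /eqP->.
  - have [[r [Vr Rr]]|VN] := pselect (V m.+1 `&` R k !=set0).
      by exists r => n le_n _; split=> //; apply: V_dec Vr.
    exists q => n; rewrite leq_eqVlt => /predU1P[->|lt_nm]; last exact: qm.
    by move=> /VN.
have [q qP] := choice (fun k => good_ex k k).
have q_near n : \forall k \near \oo, (V n `&` R k) (q k).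
  near=> k; apply: qP; first by near: k; exact: nbhs_infty_ge.
  by near: k; exact: R_near.
exists q; last by apply: filterS (q_near 0%N) => k [].
move=> O /V_base[n VnO]; apply: filterS (q_near n) => k [Vq _].
exact: VnO.
Unshelve. all: by end_near. Qed.

Theorem corollary4p3 (d : Order.disp_t) (P : POrderedTopological.type d)
    (X : topologicalType)
    (P_directed : directed (@poset_le d P))
    (P_tychonoff : tychonoff_space P)
    (P_second_countable : @second_countable P)
    (P_bounded : convergent_sequences_bounded P)
    (X_tychonoff : tychonoff_space X)
    (X_P_base : has_base P X) :
  strong_pytkeev_star X.
Proof.
move=> x; have [U [Ux U_anti U_base]] := antitone_neighborhood_base (X_P_base x).
have [B B_count [_ B_base]] := P_second_countable.
pose net (W : set P) := \bigcap_(q in W) U q.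
exists (net @` B).
  by apply: sub_countable B_count; apply: card_image_le.
move=> O u xO u_clusters; have [p UpO] := U_base O xO.
apply: contrapT => no_net.
have [q q_cvg q_near] : exists2 q : nat -> P,
    q @ \oo --> p & \forall k \near \oo, ~ U (q k) (u k).
  (* [R k] collects the indices whose base set omits [u k]; a basic [W] around [p] meets it whenever
     [u k] lies outside [net W]. *)
  apply: (diagonal_sequence p (fun k => [set q | ~ U q (u k)])) => // V.
  move=> /B_base[W [BW Wp] WV].
  (* Since [p] is in [W], [net W] lies in [U p] and hence in [O]; were this set infinite, [net W]
     would contradict [no_net]. *)
  have /finite_set_near_infty : finite_set [set k | net W (u k)].
    apply: contrapT => W_inf; apply: no_net; exists (net W); split => //.
    by move=> y /(_ p Wp) /UpO.
  apply: filterS => k /existsNP[r /not_implyP[Wr nUr]].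
  by exists r; split => //; apply: WV.
have [b le_qb] := P_bounded q p q_cvg.
apply: (u_clusters (U b) (Ux b)); apply/finite_set_near_infty.
by apply: filterS q_near => k nUq Ub; apply/nUq/(U_anti _ b).
Qed.
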